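(* Let $p>2$ be a prime, let $m,n,r>0$ be natural numbers, let $s>1$ be an integer, and let $k$ be a key. The $s$-round generalized Rijndael-like function $T_s[k]: M_{m,n}(\mathrm{GF}(p^r))\to M_{m,n}(\mathrm{GF}(p^r))$ is an odd permutation if (i) $s$ is even and $\rho$ is an odd permutation, or else (ii) $s$ is odd and either $\pi$ or $\lambda$ is an odd permutation.
   Context: $M_{m,n}(\mathrm{GF}(p^r))$ is the set of $m\times n$ matrices over $\mathrm{GF}(p^r)$, with rows indexed by $0\le i<m$ and columns by $0\le j<n$. All maps below are permutations of the finite set $M_{m,n}(\mathrm{GF}(p^r))$, and ''odd''/''even'' refers to their parity as such. Component functions: - For $\kappa\in M_{m,n}(\mathrm{GF}(p^r))$, $\sigma[\kappa](a)=a+\kappa$ (entrywise addition). - $\lambda$ applies to every entry the same S-box: $\lambda(a)_{ij}=A\,a_{ij}^{-1}+B$ if $a_{ij}\ne 0$ and $\lambda(a)_{ij}=B$ if $a_{ij}=0$, where $A,B\in\mathrm{GF}(p^r)$ are fixed and $A\neq 0$ (so that the S-box is bijective). - $\pi$ is given by $\pi(a)_{ij}=a_{i,(j-c(i)) \bmod n}$, where $c:\{0,\dots,m-1\}\to\{0,\dots,n-1\}$ is a fixed map. - $\rho$ multiplies each column by a fixed invertible matrix $C\in M_{m,m}(\mathrm{GF}(p^r))$ (the ''diffusion matrix''), i.e. $\rho(a)=C a$. A key $k$ produces, via a key schedule, subkeys $k_1,\dots,k_{s+1}\in M_{m,n}(\mathrm{GF}(p^r))$. The $s$-round generalized Rijndael-like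 function is $$T_s[k]=\sigma[k_{s+1}]\circ\pi\circ\lambda\circ(\sigma[k_s]\circ\rho\circ\pi\circ\lambda)\circ\cdots\circ(\sigma[k_2]\circ\rho\circ\pi\circ\lambda)\circ\sigma[k_1],$$ with one bracketed factor for each $i=2,\dots,s$. *)

(* Defs.v *)
From HB Require Import structures.
From mathcomp Require Import all_boot all_order all_algebra all_fingroup.

Set Implicit Arguments.
Unset Strict Implicit.
Unset Printing Implicit Defensive.

Import GRing.Theory.
Local Open Scope ring_scope.

(* The claim that f is bijective is part of the predicate; the parity is the
   one of f as a permutation of the whole finite type T. *)
Definition odd_permutation (T : finType) (f : T -> T) : Prop :=
  exists2 u : {perm T}, f =1 u & odd_perm u.

Definition sigma_map (F : finFieldType) (m n : nat) (kappa : 'M[F]_(m, n))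
    (a : 'M[F]_(m, n)) : 'M[F]_(m, n) :=
  a + kappa.

Definition sbox (F : finFieldType) (A B : F) (x : F) : F :=
  if x == 0 then B else A * x^-1 + B.

Definition lambda_map (F : finFieldType) (m n : nat) (A B : F)
    (a : 'M[F]_(m, n)) : 'M[F]_(m, n) :=
  \matrix_(i, j) sbox A B (a i j).

(* (j - d) mod n; adding n first avoids the truncation of nat subtraction. *)
Definition ord_subm (n : nat) (j d : 'I_n) : 'I_n :=
  Ordinal (ltn_pmod (j + n - d)%N (leq_ltn_trans (leq0n j) (ltn_ord j))).

Definition pi_map (F : finFieldType) (m n : nat) (c : 'I_m -> 'I_n)
    (a : 'M[F]_(m, n)) : 'M[F]_(m, n) :=
  \matrix_(i, j) a i (ord_subm j (c i)).

Definition rho_map (F : finFieldType) (m n : nat) (C : 'M[F]_m)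
    (a : 'M[F]_(m, n)) : 'M[F]_(m, n) :=
  C *m a.

Definition round_map (F : finFieldType) (m n : nat) (A B : F)
    (c : 'I_m -> 'I_n) (C : 'M[F]_m) (kappa : 'M[F]_(m, n)) :
    'M[F]_(m, n) -> 'M[F]_(m, n) :=
  sigma_map kappa \o rho_map C \o pi_map c \o lambda_map A B.

(* The subkey k_i is sk i; only sk 1, ..., sk s.+1 are used.  The iteri term is
   round_map (sk s) \o ... \o round_map (sk 2), with s.-1 factors. *)
Definition rijndael_like (F : finFieldType) (m n : nat) (A B : F)
    (c : 'I_m -> 'I_n) (C : 'M[F]_m) (s : nat) (sk : nat -> 'M[F]_(m, n)) :
    'M[F]_(m, n) -> 'M[F]_(m, n) :=
  sigma_map (sk s.+1) \o pi_map c \o lambda_map A B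
    \o iteri s.-1 (fun i => round_map A B c C (sk i.+2))
    \o sigma_map (sk 1%N).

(* Main.v *)
Require Import Defs.
From HB Require Import structures.
From mathcomp Require Import all_boot all_order all_algebra all_fingroup.
From mathcomp Require Import finfield.

Set Implicit Arguments.
Unset Strict Implicit.
Unset Printing Implicit Defensive.

Import GRing.Theory.
Local Open Scope ring_scope.

(** Parity is additive under composition, so the parity of T_s is
      s * (parity of pi + parity of lambda) + (s - 1) * (parity of rho)
    plus the parities of the key additions.  A key addition is even: as the
    field has odd characteristic, translation by kappa is the square of
    translation by kappa / 2 ([has_parity_sigma]).  For even s the sum reduces
    to the parity of rho, and for odd s to that of pi plus that of lambda.

    In the second case it remains to see that pi and lambda cannot both be
    odd, so that one of them being odd makes the sum odd.  This is decided by
    the parity of n, the number of columns.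
    - If n is odd, 2 is invertible modulo n, so the row shifts pi with offsets
      c are the square of the shifts with offsets c / 2, and pi is even
      ([has_parity_pi_odd]).
    - If n is even, lambda is the product of its n restrictions to single
      columns.  These are conjugate to one another by column swaps, so they
      all have the same parity, and lambda is even ([has_parity_lambda_even]). *)

(** * Parity of self-maps of a finite type *)

(** The parity is a relation, which avoids carrying injectivity proofs inside
    terms; [has_parity f true] is convertible to [odd_permutation f]. *)
Definition has_parity (T : finType) (f : T -> T) (b : bool) : Prop :=
  exists2 u : {perm T}, f =1 u & odd_perm u = b.

Section Parity.
Variable T : finType.
Implicit Types (f g : T -> T) (a b : bool).

Lemma has_parity_ext f g b : f =1 g -> has_parity f b -> has_parity g b.
Proof. by move=> fg [u fu ub]; exists u => // x; rewrite -fg fu. Qed.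

Lemma has_parity_unique f a b : has_parity f a -> has_parity f b -> a = b.
Proof.
move=> [u fu <-] [v fv <-]; congr odd_perm.
by apply/permP => x; rewrite -fu fv.
Qed.

Lemma has_parity_inj f : injective f -> exists b, has_parity f b.
Proof.
by move=> f_inj; exists (perm f_inj); exists (perm f_inj) => // x; rewrite permE.
Qed.

Lemma has_parity_id : has_parity (@id T) false.
Proof. by exists 1%g; [move=> x; rewrite perm1 | rewrite odd_perm1]. Qed.

Lemma has_parity_comp f g a b :
  has_parity f a -> has_parity g b -> has_parity (f \o g) (a (+) b).
Proof.
move=> [u fu <-] [v gv <-]; exists (v * u)%g; last by rewrite odd_permM addbC.
by move=> x; rewrite permM /= gv fu.
Qed.

Lemma has_parity_square f : injective f -> has_parity (f \o f) false.
Proof.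
by move=> /has_parity_inj[b fb]; rewrite -(addbb b); apply: has_parity_comp.
Qed.

Lemma has_parity_conj_involution f h b :
  involutive h -> has_parity f b -> has_parity (h \o f \o h) b.
Proof.
move=> hK fb; have [a ha] := has_parity_inj (inv_inj hK).
have -> : b = (a (+) b) (+) a by rewrite [a (+) b]addbC addbK.
exact: has_parity_comp (has_parity_comp ha fb) ha.
Qed.

Lemma has_parity_iteri (f : nat -> T -> T) b t :
  (forall i, has_parity (f i) b) -> has_parity (iteri t f) (odd t && b).
Proof.
move=> fb; elim: t => [|t IHt]; first exact: has_parity_id.
have -> : odd t.+1 && b = b (+) (odd t && b)
  by rewrite /=; case: (odd t); rewrite ?addbb ?addbF.
exact: has_parity_comp (fb t) IHt.
Qed.

End Parity.

(** * The component functions *)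

Section Components.
Variables (F : finFieldType) (m n : nat).
Implicit Types (a kappa : 'M[F]_(m, n)) (c : 'I_m -> 'I_n).

Lemma sigma_map_inj kappa : injective (sigma_map kappa).
Proof. exact: addIr. Qed.

Lemma has_parity_sigma kappa :
  2%:R != 0 :> F -> has_parity (sigma_map kappa) false.
Proof.
move=> two_neq0; pose half := (2%:R)^-1 *: kappa.
apply: has_parity_ext (has_parity_square (sigma_map_inj (kappa := half))) => a.
by rewrite /= /sigma_map -addrA -mulr2n -scaler_nat scalerA divff ?scale1r.
Qed.

Lemma rho_map_inj (C : 'M[F]_m) :
  C \in unitmx -> injective (@rho_map F m n C).
Proof. by move=> C_unit; apply: can_inj (mulKmx C_unit). Qed.

Lemma ord_subm_addn (j d : 'I_n) : (ord_subm j d + d = j %[mod n])%N.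
Proof. by rewrite /= modnDml subnK ?modnDr // ltnW ?ltn_addl. Qed.

Lemma ord_subm_unique (j d e : 'I_n) :
  (e + d = j %[mod n])%N -> ord_subm j d = e.
Proof.
rewrite -(ord_subm_addn j d) => /eqP; rewrite eqn_modDr !modn_small // => /eqP eq_e.
exact: val_inj.
Qed.

Lemma ord_subm_inj (d : 'I_n) : injective ((@ord_subm n)^~ d).
Proof.
move=> j k eq_jk; apply: val_inj => /=.
by rewrite -(modn_small (ltn_ord j)) -(ord_subm_addn j d) eq_jk ord_subm_addn modn_small.
Qed.

Lemma pi_map_inj c : injective (@pi_map F m n c).
Proof.
move=> a b /matrixP eq_ab; apply/matrixP => i j.
have [g _ gK] := injF_bij (@ord_subm_inj (c i)).
by have := eq_ab i (g j); rewrite !mxE gK.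
Qed.

Lemma has_parity_pi_odd c : odd n -> has_parity (@pi_map F m n c) false.
Proof.
move=> n_odd; have n_gt0 := odd_gt0 n_odd.
(* for odd n, (n + 1) / 2 is the inverse of 2 modulo n *)
pose half i := Ordinal (ltn_pmod (c i * n.+1./2) n_gt0).
apply: has_parity_ext (has_parity_square (pi_map_inj (c := half))) => a.
apply/matrixP => i j; rewrite !mxE; congr (a i _).
apply/esym/ord_subm_unique.
have c_half : (c i = half i + half i %[mod n])%N.
  rewrite /= modnDm addnn doubleMr.
  have /= -> : (n.+1./2.*2 = n.+1)%N by rewrite even_halfK //= n_odd.
  by rewrite mulnS addnC modnMDl.
rewrite -modnDmr c_half modnDmr addnA.
by rewrite -modnDml ord_subm_addn modnDml ord_subm_addn.
Qed.

(** As 0^-1 = 0 in a field type, the S-box is x |-> A * x^-1 + B without any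
    case distinction, a composite of injections. *)
Lemma sbox_inj (A B : F) : A != 0 -> injective (sbox A B).
Proof.
move=> A_neq0 x y.
have sboxE z : sbox A B z = A * z^-1 + B.
  by rewrite /sbox; case: eqP => // ->; rewrite invr0 mulr0 add0r.
by rewrite !sboxE => /addIr /(mulfI A_neq0) /invr_inj.
Qed.

(** One family contains the single-column maps (P = pred1 j), the identity and
    the full entrywise map; the prefixes l < t interpolate between the last
    two. *)
Definition map_columns (g : F -> F) (P : pred 'I_n) a : 'M[F]_(m, n) :=
  \matrix_(i, l) if P l then g (a i l) else a i l.

Lemma map_columns_inj g P : injective g -> injective (map_columns g P).
Proof.
move=> g_inj a b /matrixP eq_ab; apply/matrixP => i l.
by have := eq_ab i l; rewrite !mxE; case: (P l) => // /g_inj.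
Qed.

(** Swapping columns j and j' conjugates the action on one of them into the
    action on the other. *)
Lemma has_parity_map_column g (j j' : 'I_n) b :
  has_parity (map_columns g (pred1 j)) b ->
  has_parity (map_columns g (pred1 j')) b.
Proof.
have swapK : involutive (@xcol F m n j j').
  by move=> a; apply/matrixP => i l; rewrite !mxE tpermK.
move=> /(has_parity_conj_involution swapK); apply: has_parity_ext => a.
apply/matrixP => i l; rewrite !mxE tpermK /=; congr (if _ then _ else _).
by rewrite -(inj_eq (@perm_inj _ (tperm j j'))) tpermK tpermL.
Qed.

(** Extending the prefix by one column composes with a single-column map, and
    all of those have the parity b of the map on column j0. *)
Lemma has_parity_map_prefix g (j0 : 'I_n) b t :
  has_parity (map_columns g (pred1 j0)) b -> (t <= n)%N ->
  has_parity (map_columns g (fun l => (l < t)%N)) (odd t && b).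
Proof.
move=> gb; elim: t => [_|t IHt lt_tn].
  apply: has_parity_ext (has_parity_id _) => a.
  by apply/matrixP => i l; rewrite mxE.
have -> : odd t.+1 && b = b (+) (odd t && b)
  by rewrite /=; case: (odd t); rewrite ?addbb ?addbF.
have tb := has_parity_map_column (Ordinal lt_tn) gb.
apply: has_parity_ext (has_parity_comp tb (IHt (ltnW lt_tn))) => a.
apply/matrixP => i l; rewrite !mxE /= -val_eqE /= ltnS.
by case: ltngtP => //; rewrite mxE.
Qed.

Lemma lambda_map_columns (A B : F) :
  @lambda_map F m n A B =1 map_columns (sbox A B) (fun l => (l < n)%N).
Proof. by move=> a; apply/matrixP => i l; rewrite !mxE ltn_ord. Qed.

Lemma lambda_map_inj (A B : F) : A != 0 -> injective (@lambda_map F m n A B).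
Proof.
move=> A_neq0; apply: eq_inj (fsym (lambda_map_columns A B)).
exact/map_columns_inj/sbox_inj.
Qed.

Lemma has_parity_lambda_even (A B : F) :
  A != 0 -> (0 < n)%N -> ~~ odd n -> has_parity (@lambda_map F m n A B) false.
Proof.
move=> A_neq0 n_gt0 n_even; pose j0 := Ordinal n_gt0.
have sbox_AB_inj : injective (sbox A B) by apply: sbox_inj.
have [b gb] := has_parity_inj (map_columns_inj (P := pred1 j0) sbox_AB_inj).
apply: has_parity_ext (fsym (lambda_map_columns A B)) _.
by have := has_parity_map_prefix gb (leqnn n); rewrite (negPf n_even).
Qed.

End Components.

(** * The parity of the cipher *)

(** The s.+1 rounds are s full rounds and a last one without rho; the key
    additions contribute nothing. *)
Lemma has_parity_rijndael (F : finFieldType) (m n : nat) (A B : F)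
    (c : 'I_m -> 'I_n) (C : 'M[F]_m) (s : nat) (sk : nat -> 'M[F]_(m, n))
    (bl bp br : bool) :
  2%:R != 0 :> F ->
  has_parity (@lambda_map F m n A B) bl ->
  has_parity (@pi_map F m n c) bp ->
  has_parity (@rho_map F m n C) br ->
  has_parity (rijndael_like A B c C s.+1 sk)
    ((bp (+) bl) (+) (odd s && (br (+) bp (+) bl))).
Proof.
move=> two_neq0 Pl Pp Pr; have Ps kappa := @has_parity_sigma F m n kappa two_neq0.
have Pround i : has_parity (round_map A B c C (sk i.+2)) (br (+) bp (+) bl).
  exact: has_parity_comp (has_parity_comp (has_parity_comp (Ps _) Pr) Pp) Pl.
have Prounds := has_parity_iteri s Pround.
have Plast := has_parity_comp (has_parity_comp (Ps (sk s.+2)) Pp) Pl.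
have := has_parity_comp (has_parity_comp Plast Prounds) (Ps (sk 1%N)).
by rewrite addbF.
Qed.

Lemma two_neq0_odd_pchar (F : finFieldType) (p r : nat) :
  prime p -> (2 < p)%N -> #|F| = (p ^ r)%N -> 2%:R != 0 :> F.
Proof.
move=> p_pr p_gt2 cardF; have charF := card_finPcharP cardF p_pr.
by rewrite -(dvdn_pcharf charF) gtnNdvd.
Qed.

Theorem theorem33 (p m n r : nat) (hp : prime p) (hp2 : (2 < p)%N)
  (hm : (0 < m)%N) (hn : (0 < n)%N) (hr : (0 < r)%N)
  (F : finFieldType) (hF : #|F| = (p ^ r)%N)
  (A B : F) (hA : A != 0) (c : 'I_m -> 'I_n)
  (C : 'M[F]_m) (hC : C \in unitmx)
  (s : nat) (hs : (1 < s)%N)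
  (K : Type) (key_schedule : K -> nat -> 'M[F]_(m, n)) (k : K) :
  (~~ odd s /\ odd_permutation (@rho_map F m n C)) \/
  (odd s /\ (odd_permutation (@pi_map F m n c) \/
             odd_permutation (@lambda_map F m n A B))) ->
  odd_permutation (rijndael_like A B c C s (key_schedule k)).
Proof.
have [bl Pl] := has_parity_inj (@lambda_map_inj F m n A B hA).
have [bp Pp] := has_parity_inj (@pi_map_inj F m n c).
have [br Pr] := has_parity_inj (@rho_map_inj F m n C hC).
have two_neq0 := two_neq0_odd_pchar hp hp2 hF.
have not_both : ~~ (bp && bl).
  have [n_odd | n_even] := boolP (odd n).
    by rewrite (has_parity_unique Pp (has_parity_pi_odd F c n_odd)).
  rewrite (has_parity_unique Pl (has_parity_lambda_even m B hA hn n_even)).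
  by rewrite andbF.
case: s hs => // s _.
have := has_parity_rijndael s (key_schedule k) two_neq0 Pl Pp Pr.
case=> [u T_u u_par] H; exists u => //; rewrite u_par.
case: H => /= [[]|[]].
  (* pi and lambda occur an even number of times each and cancel *)
  rewrite negbK => -> /(has_parity_unique Pr) ->.
  by case: (bp); case: (bl).
move=> /negPf -> /=; rewrite addbF.
case=> [/(has_parity_unique Pp) eq_p|/(has_parity_unique Pl) eq_l].
  by move: not_both; rewrite eq_p; case: (bl).
by move: not_both; rewrite eq_l; case: (bp).
Qed.
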